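(* Assume that $\operatorname{cov}(\mathcal{M})=\operatorname{cof}(\mathcal{M})$ and that the cardinal number $\operatorname{cov}(\mathcal{M})$ is regular. Then for every $\operatorname{cov}(\mathcal{M})$-Luzin set $X\subseteq\mathbb{Z}^{\mathbb{N}}$ there is a $\operatorname{cov}(\mathcal{M})$-Luzin set $Y\subseteq\mathbb{Z}^{\mathbb{N}}$ such that the product space $X\times Y$ is not Menger.
   Context: $\mathbb{Z}$ is the discrete space of integers and $\mathbb{Z}^{\mathbb{N}}$ has the Tychonoff product topology. $\operatorname{cov}(\mathcal{M})$ is the minimal cardinality of a family of meager subsets of $\mathbb{R}$ that covers $\mathbb{R}$; $\operatorname{cof}(\mathcal{M})$ is the minimal cardinality of a family of meager subsets of $\mathbb{R}$ such that every meager subset of $\mathbb{R}$ is contained in a member of the family (replacing $\mathbb{R}$ by $\mathbb{Z}^{\mathbb{N}}$ gives the same cardinals). A set $X\subseteq\mathbb{Z}^{\mathbb{N}}$ is a $\operatorname{cov}(\mathcal{M})$-Luzin set if $|X|\ge\operatorname{cov}(\mathcal{M})$ and $|X\cap M|<\operatorname{cov}(\mathcal{M})$ for every meager set $M\subseteq\mathbb{Z}^{\mathbb{N}}$. A space $X$ is Menger if for every sequence $\mathcal{U}_1,\mathcal{U}_2,\dots$ of open covers of $X$ there are finite $\mathcal{F}_1\subseteq\mathcal{U}_1,\mathcal{F}_2\subseteq\mathcal{U}_2,\dots$ such that $\bigcup_n\mathcal{F}_n$ covers $X$. *)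

(* Defs.v *)
From HB Require Import structures.
From mathcomp Require Import all_boot all_order all_algebra.
From mathcomp Require Import all_classical all_reals all_analysis.

Set Implicit Arguments.
Unset Strict Implicit.
Unset Printing Implicit Defensive.

Import Order.TTheory GRing.Theory Num.Theory.
Import numFieldNormedType.Exports.

Local Open Scope classical_set_scope.
Local Open Scope card_scope.

(** A cardinal number is represented by any set of that cardinality. *)

Definition card_lt T U (A : set T) (B : set U) : Prop :=
  A #<= B /\ ~ (B #<= A).
Notation "A '#<' B" := (card_lt A B) (at level 79) : card_scope.

Definition is_min_card U (P : set (set U)) (A : set U) : Prop :=
  P A /\ forall B, P B -> A #<= B.

(** A chosen member of least cardinality, which exists as soon as [P] is
    nonempty ([min_cardP]). *)
Definition min_card U (P : set (set U)) : set U := get (is_min_card P).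

(** Regularity without ordinals: the cofinality of an infinite cardinal is
    the least number of smaller sets whose union is the whole cardinal.
    Indexing the union by a set [F] of subsets loses no generality, since
    repeated members can be dropped. *)
Definition regular_card U (K : set U) : Prop :=
  infinite_set K /\
  forall F : set (set U), F #< K -> (forall A, F A -> A #< K) ->
    \bigcup_(A in F) A <> K.

Section category.
Variable T : topologicalType.
Implicit Types (A M N : set T) (F : set (set T)).

Definition nowhere_dense A : Prop := interior (closure A) = set0.

Definition meager A : Prop :=
  exists2 F : nat -> set T,
    (forall n, nowhere_dense (F n)) & A = \bigcup_n F n.

Definition meager_covering F : Prop :=
  F `<=` meager /\ \bigcup_(M in F) M = setT.

Definition meager_cofinal F : Prop :=
  F `<=` meager /\ forall M, meager M -> exists2 N, F N & M `<=` N.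

(** cov(M) and cof(M) computed in the space [T]; the cardinals of the
    literature are those of the real line. *)
Definition cov_meager : set (set T) := min_card meager_covering.
Definition cof_meager : set (set T) := min_card meager_cofinal.

(** [K] stands for the cardinal; a cov(M)-Luzin set is [luzin] for
    [K := cov_meager R]. *)
Definition luzin U (K : set U) (X : set T) : Prop :=
  K #<= X /\ forall M, meager M -> (X `&` M) #< K.

Definition open_cover F : Prop :=
  F `<=` open /\ \bigcup_(V in F) V = setT.

Definition menger : Prop :=
  forall C : nat -> set (set T), (forall n, open_cover (C n)) ->
  exists F : nat -> set (set T),
    (forall n, finite_set (F n) /\ F n `<=` C n) /\
    \bigcup_n \bigcup_(V in F n) V = setT.

End category.
Arguments menger : clear implicits.
Arguments cov_meager : clear implicits.
Arguments cof_meager : clear implicits.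
Arguments meager_covering : clear implicits.
Arguments meager_cofinal : clear implicits.

Definition baireZ : topologicalType :=
  prod_topology (fun _ : nat => discrete_topology int).

Lemma min_cardP U (P : set (set U)) : P !=set0 -> is_min_card P (min_card P).
Proof.
move=> [A0 PA0]; rewrite /min_card; apply: (@getPex _ (is_min_card P)).
have [P0|P0] := pselect (P set0).
  by exists set0; split=> // B _; exact: card_ge0.
pose Q (G : set (set U -> U)) :=
  (forall f A, G f -> P A -> A (f A)) /\
  (forall f g A, G f -> G g -> P A -> f A = g A -> f = g).
have [|G [[GA Ginj] Gmax]] := @Zorn_bigcup _ Q.
  move=> F FQ totF; split=> [f A [H FH Hf]|f g A [H FH Hf] [H' FH' Hg]].
    exact: (FQ _ FH).1 f A Hf.
  have [HH|HH] := totF _ _ FH FH'.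
    by apply: (FQ _ FH').2 => //; exact: HH.
  by apply: (FQ _ FH).2 => //; exact: HH.
have [A PA Aonto] : exists2 A, P A & forall a, A a -> exists2 g, G g & g A = a.
  apply: contrapT => noA.
  have /choice[h hP] : forall A, exists a, P A ->
      A a /\ forall g, G g -> g A <> a.
    move=> A; have [PA|nPA] := pselect (P A); last first.
      have [u _] : A0 !=set0.
        by apply/set0P/eqP => A00; rewrite A00 in PA0.
      by exists u => /nPA.
    apply: contrapT => noa; apply: noA; exists A => // a Aa.
    apply: contrapT => nog; apply: noa; exists a => _; split=> // g Gg gA.
    by apply: nog; exists g.
  have nGh : ~ G h by move=> /(hP _ PA0).2; exact.
  apply: (Gmax (G `|` [set h])).
    split=> [|/(_ h)]; first by move=> g; left.
    by move=> Gh; apply/nGh/Gh; right.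
  split=> [f A [Gf|->] PA|f g A [Gf|->] [Gg|->] PA //].
  - exact: (GA f A Gf PA).
  - exact: (hP _ PA).1.
  - exact: (Ginj f g A Gf Gg PA).
  - by move=> fhA; case: ((hP _ PA).2 f Gf fhA).
  - by move=> /esym ghA; case: ((hP _ PA).2 g Gg ghA).
exists A; split=> // B PB; apply: (@card_le_trans _ _ _ G).
  apply: card_le_trans (card_image_le (fun g => g A) G).
  by apply: subset_card_le => a /Aonto[g Gg <-]; exists g.
have f_inj : {in G &, injective (fun g : set U -> U => g B)}.
  by move=> f g /set_mem Gf /set_mem Gg; move=> fgB; exact: (Ginj f g B Gf Gg PB fgB).
rewrite -(card_le_eql (inj_card_eq f_inj)).
by apply: subset_card_le => _ [g Gg <-]; exact: (GA g B Gg PB).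
Qed.

Lemma cof_meagerP (T : topologicalType) :
  is_min_card (meager_cofinal T) (cof_meager T).
Proof.
by apply: min_cardP; exists (@meager T); split=> // M mM; exists M.
Qed.

Lemma cov_meagerP (R : realType) :
  is_min_card (meager_covering R) (cov_meager R).
Proof.
apply: min_cardP; exists (@meager R); split=> //.
apply/seteqP; split=> // x _; exists [set x] => //.
exists (fun=> [set x]); last by rewrite bigcup_const.
move=> _; rewrite /nowhere_dense.
rewrite -(proj1 (closure_id _) (@accessible_closed_set1 _ _ x)); last first.
  exact/hausdorff_accessible/Rhausdorff.
apply/seteqP; split=> // y xy.
have yx := interior_subset xy; rewrite /= in yx; subst y.
have := xy => /nbhs_ballP[e /= e0 /(_ (x + e / 2)%R)].
rewrite /ball/= opprD addrA subrr add0r normrN gtr0_norm ?divr_gt0//.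
rewrite ltr_pdivrMr// mulr_natr mulr2n ltrDl => /(_ e0) /eqP.
by rewrite -subr_eq0 addrAC subrr add0r mulf_eq0 invr_eq0 gt_eqF ?pnatr_eq0.
Qed.

(* Main.v *)
Require Import Defs.
From mathcomp Require Import all_boot all_order all_algebra.
From mathcomp Require Import all_classical all_reals all_analysis.
From mathcomp Require Import lra.
From mathcomp Require wochoice.

(** Let K = cov(M) = cof(M). There are meager sets M_a (a in K) cofinal in the
    meager subsets of Z^N and, since d <= cof(M), a dominating family of points
    z_a (a in K) of Z^N. Well-order K with all initial segments smaller than K. The sets
    z_a - M_b (b <= a) are fewer than K and meager, so each meets the Luzin set X
    in less than K points and, by regularity, some x_a in X avoids all of them:
    y_a := z_a - x_a lies outside M_b for every b <= a. Hence
    Y := {y_a : a in K} meets each meager set in less than K points; a value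
    y_a = v is possible only for a bounded set of indices a, so regularity also
    gives |Y| >= K. Finally the sums x + y (x in X, y in Y) include every z_a,
    so they form a dominating family, whereas continuous images of Menger spaces in Z^N
    are not. *)

Set Implicit Arguments.
Unset Strict Implicit.
Unset Printing Implicit Defensive.

Import Order.TTheory GRing.Theory Num.Theory.
Import numFieldNormedType.Exports.
Local Open Scope classical_set_scope.
Local Open Scope card_scope.

(** * Cylinders of Z^N *)

Lemma nowhere_denseP (T : topologicalType) (A : set T) :
  nowhere_dense A <->
  forall V, open V -> V !=set0 ->
    exists W, [/\ open W, W !=set0, W `<=` V & W `&` A = set0].
Proof.
split=> [A0 V oV [x Vx]|dA].
  have [y [Vy nAy]] : exists y, V y /\ ~ closure A y.
    apply: contrapT => VA; suff : (closure A)^° x by rewrite A0.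
    rewrite /interior nbhsE; exists V => // y Vy; apply: contrapT => nAy.
    by apply: VA; exists y.
  exists (V `&` ~` closure A); split=> //.
  - by apply: openI => //; exact/closed_openC/closed_closure.
  - by exists y.
  - apply/seteqP; split=> // z [[_ nAz] Az]; exact/nAz/subset_closure.
apply/seteqP; split=> // x Ax.
have [|W [oW [y Wy] WA WA0]] := dA _ (@open_interior _ (closure A)).
  by exists x.
have /(_ W) [|z [Az Wz]] := interior_subset (WA _ Wy); first exact: open_nbhs_nbhs.
by have : set0 z by rewrite -WA0.
Qed.

Definition agree (k : nat) (x y : baireZ) := forall i, (i < k)%N -> x i = y i.

Lemma agree_le k m x y : (k <= m)%N -> agree m x y -> agree k x y.
Proof. by move=> km xy i ik; apply: xy; exact: leq_trans km. Qed.

Lemma agree_trans k x y z : agree k x y -> agree k y z -> agree k x z.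
Proof. by move=> xy yz i ik; rewrite xy// yz. Qed.

Lemma nbhs_baireZ (x : baireZ) (U : set baireZ) :
  nbhs x U <-> exists k, forall y, agree k x y -> U y.
Proof.
split=> [|[k kU]].
  pose F : set_system baireZ :=
    fun V => exists k, forall y, agree k x y -> V y.
  have FF : Filter F.
    split; first by exists 0%N.
      move=> P Q [k kP] [m mQ]; exists (maxn k m) => y xy.
      by split; [apply: kP|apply: mQ]; apply: agree_le xy; rewrite ?leq_maxl ?leq_maxr.
    by move=> P Q PQ [k kP]; exists k => y /kP; exact: PQ.
  (* The product topology is a supremum over the coordinates, so convergence of the filter of
     cylinders is tested one coordinate at a time. *)
  suff : cvg_to F (nbhs x) by move=> /(_ U).
  apply/cvg_sup => N V [_ [[W oW <-] WxN WV]].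
  by exists N.+1 => y xy; apply: WV => /=; rewrite -[y N]xy.
apply: (@filterS _ _ _ [set y | agree k x y]) => [y /kU//|].
elim: k {kU} => [|k IH]; first by apply: filterS filterT => y _ i.
have xk : nbhs x [set y : baireZ | y k = x k].
  exact: (@proj_continuous _ (fun=> discrete_topology int) k x [set x k]).
apply: filterS (filterI IH xk) => y [/= xy yx] i.
by rewrite ltnS leq_eqVlt => /orP[/eqP->//|/xy].
Qed.

Lemma open_agree k x : open [set y | agree k x y].
Proof.
rewrite openE => y xy; apply/nbhs_baireZ; exists k => z; exact: agree_trans.
Qed.

Definition avoid m y (A : set baireZ) := forall z, agree m y z -> ~ A z.

Lemma avoid_le m p y A : (m <= p)%N -> avoid m y A -> avoid p y A.
Proof. by move=> mp yA z /(agree_le mp)/yA. Qed.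

Lemma nowhere_dense_baireZ (A : set baireZ) :
  nowhere_dense A <->
  forall x k, exists y m, agree k x y /\ avoid m y A.
Proof.
split=> [/nowhere_denseP dA x k|dA].
  have [|W [oW [y Wy] Wx WA]] := dA _ (open_agree k x); first by exists x.
  have /nbhs_baireZ[m mW] : nbhs y W by apply: open_nbhs_nbhs.
  exists y, m; split; first exact: Wx.
  by move=> z yz Az; have : set0 z by rewrite -WA; split=> //; exact: mW.
apply/nowhere_denseP => V oV [x Vx].
have /nbhs_baireZ[k kV] : nbhs x V by apply: open_nbhs_nbhs.
have [y [m [xy yA]]] := dA x k.
exists [set z | agree (maxn k m) y z]; split.
- exact: open_agree.
- by exists y.
- by move=> z yz; apply: kV; apply: agree_trans xy (agree_le (leq_maxl _ _) yz).
- by apply/seteqP; split=> // z [/(agree_le (leq_maxr _ _))/yA].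
Qed.

(** The map [x |-> z - x] is its own inverse, so its preimage of [M] is the set [z - M]. *)
Definition reflect_at (z x : baireZ) : baireZ := fun n =>
  ((z n : int) - x n)%R.

Lemma reflect_atK z : involutive (reflect_at z).
Proof.
by move=> x; apply/funext => n; rewrite /reflect_at opprB addrC subrK.
Qed.

Lemma agree_reflect z k x y :
  agree k x y -> agree k (reflect_at z x) (reflect_at z y).
Proof. by move=> xy i ik; rewrite /reflect_at xy. Qed.

Lemma meager_reflect z M : meager M -> meager (reflect_at z @^-1` M).
Proof.
move=> [F Fn ->]; exists (fun n => reflect_at z @^-1` F n).
  move=> n; apply/nowhere_dense_baireZ => x k.
  have /nowhere_dense_baireZ/(_ (reflect_at z x) k)[y [m [xy yF]]] := Fn n.
  exists (reflect_at z y), m; split.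
    by rewrite -[x](reflect_atK z); exact: agree_reflect.
  by move=> w /(agree_reflect z); rewrite reflect_atK => /yF.
by rewrite preimage_bigcup.
Qed.

(** A bijective code in place of the absolute value: it measures the size of an integer, and every
    size is attained exactly once. *)
Definition nat_of_int (a : int) : nat :=
  match a with Posz n => n.*2 | Negz n => n.*2.+1 end.

Definition int_of_nat (n : nat) : int :=
  if odd n then Negz n./2 else Posz n./2.

Lemma nat_of_intK : cancel nat_of_int int_of_nat.
Proof. by case=> n; rewrite /int_of_nat /= odd_double/= ?uphalf_double ?doubleK. Qed.

Lemma int_of_natK : cancel int_of_nat nat_of_int.
Proof.
move=> n; rewrite /int_of_nat -[in RHS](odd_double_half n).
by case: odd.
Qed.

Definition below (f : nat -> nat) : set baireZ :=
  [set x | forall n, (nat_of_int (x n) <= f n)%N].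

Lemma nowhere_dense_below f : nowhere_dense (below f).
Proof.
apply/nowhere_dense_baireZ => x k.
pose y : baireZ := fun n => if n == k then int_of_nat (f k).+1 else x n.
exists y, k.+1; split; first by move=> i ik; rewrite /y ltn_eqF.
move=> z yz /(_ k); rewrite -yz// /y eqxx.
by rewrite int_of_natK ltnn.
Qed.

(** * Domination *)

Lemma avoid_finitely (F : nat -> set baireZ) :
  (forall n, nowhere_dense (F n)) ->
  forall j x k, exists y m,
    agree k x y /\ forall i, (i < j)%N -> avoid m y (F i).
Proof.
move=> Fn; elim=> [x k|j IH x k]; first by exists x, 0%N.
have [y [m [xy yF]]] := IH x k.
have /nowhere_dense_baireZ/(_ y (maxn k m))[y' [m' [yy' y'F]]] := Fn j.
exists y', (maxn m m'); split.
  by apply: agree_trans xy _; apply: agree_le yy'; exact: leq_maxl.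
move=> i; rewrite ltnS leq_eqVlt => /orP[/eqP->|/yF iF].
  exact: avoid_le (leq_maxr _ _) y'F.
move=> z y'z; apply: iF; apply: agree_trans (agree_le (leq_maxr _ _) yy') _.
exact: agree_le (leq_maxl _ _) y'z.
Qed.

(* Only finitely many words of length [k] have letters bounded by [b], so the
   extensions that escape [F 0, ..., F k] can be bounded uniformly. *)
Lemma avoid_uniformly (F : nat -> set baireZ) :
  (forall n, nowhere_dense (F n)) ->
  exists S : nat -> nat -> nat, forall k b x, below (fun=> b) x ->
    exists y, [/\ agree k x y, below (fun=> S k b) y &
      forall i, (i <= k)%N -> avoid (S k b) y (F i)].
Proof.
move=> Fn.
have /choice[S SP] : forall kb : nat * nat, exists s, forall x,
    below (fun=> kb.2) x -> exists y,
    [/\ agree kb.1 x y, below (fun=> s) y &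
      forall i, (i <= kb.1)%N -> avoid s y (F i)]; last first.
  by exists (fun k b => S (k, b)) => k b; exact: (SP (k, b)).
move=> [k b] /=.
have /choice[Y] : forall x, exists ym : baireZ * nat,
    agree k x ym.1 /\ forall i, (i < k.+1)%N -> avoid ym.2 ym.1 (F i).
  by move=> x; have [y [m ?]] := avoid_finitely Fn k.+1 x k; exists (y, m).
move=> YP.
pose pt (t : {ffun 'I_k -> 'I_b.+1}) : baireZ := fun n =>
  if insub n is Some i then int_of_nat (t i) else int_of_nat 0.
pose m t := maxn k (Y (pt t)).2.
pose s t := maxn (m t) (\max_(j < m t) nat_of_int ((Y (pt t)).1 j)).
exists (\max_t s t)%N => x xb.
pose t : {ffun 'I_k -> 'I_b.+1} := [ffun i : 'I_k => inord (nat_of_int (x i))].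
have xt : agree k x (pt t).
  move=> i ik; rewrite /pt insubT ffunE/= inordK ?nat_of_intK//.
  by rewrite ltnS; exact: xb.
(* Letters from [m t] on are reset to code 0: the cylinder of length [m t] does not see them, and
   the remaining letters have a finite maximum. *)
pose y : baireZ := fun n => if (n < m t)%N then (Y (pt t)).1 n else int_of_nat 0.
have st : (s t <= \max_t s t)%N by apply: leq_bigmax.
have [xY YF] := YP (pt t).
exists y; split.
- apply: agree_trans xt _ => i ik.
  by rewrite /y (leq_trans ik (leq_maxl _ _)) xY.
- move=> n; rewrite /y; case: ifPn => [nm|_]; last by rewrite int_of_natK.
  apply: leq_trans st; rewrite /s leq_max; apply/orP; right.
  exact: (leq_bigmax (Ordinal nm)).
- move=> i ik z yz; apply: (YF i ik) => j jm.
  have jmt : (j < m t)%N by apply: leq_trans jm (leq_maxr _ _).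
  rewrite -yz; first by rewrite /y jmt.
  by apply: leq_trans jmt (leq_trans (leq_maxl _ _) st).
Qed.

(* This is d <= cof(M): a word may take the escape prescribed at stage [k]
   without leaving [below f] as soon as [g k < f k], and if that happens for
   infinitely many [k] then a point of [below f] escapes every [F i]. *)
Lemma domination (M : set baireZ) : meager M ->
  exists g : nat -> nat, forall f, {homo f : m n / (m <= n)%N} ->
    below f `<=` M -> exists N, forall n, (N <= n)%N -> (f n <= g n)%N.
Proof.
move=> [F Fn ->]; have [S SP] := avoid_uniformly Fn.
(* [b k] bounds the letters of a word at stage [k], and [b k.+1] covers both the letters and the
   length of an escape made there. *)
pose b := fix b k := if k is k.+1 then (b k + S k (b k) + k.+1)%N else 0%N.
have bS k : b k.+1 = (b k + S k (b k) + k.+1)%N by [].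
have kb k : (k <= b k)%N by case: k => // k; rewrite bS leq_addl.
have b_homo : {homo b : m n / (m <= n)%N}.
  by apply: homo_leq => [//|? ? ?|k]; [exact: leq_trans|rewrite bS -addnA leq_addr].
exists (fun k => b k.+1) => f f_homo fF; apply: contrapT => nfb.
have f_large k : exists2 k', (k <= k')%N & (b k'.+1 < f k')%N.
  apply: contrapT => nk; apply: nfb; exists k => n kn; rewrite leqNgt.
  by apply/negP => bf; apply: nk; exists n.
pose Inv (p : nat * baireZ) := below (fun=> b p.1) p.2 /\ below f p.2.
have /choice[next nextP] : forall p, exists q, Inv p ->
    [/\ Inv q, (p.1 < q.1)%N, agree p.1 p.2 q.2 &
      forall i, (i <= p.1)%N -> avoid q.1 q.2 (F i)].
  move=> [k y]; have [[/= yb yf]|nI] := pselect (Inv (k, y)); last by exists (k, y).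
  have [k' kk' bf] := f_large k.
  have [|y' [yy' y'S y'F]] := SP k' (b k') y.
    by move=> n; apply: leq_trans (yb n) _; exact: b_homo.
  have Sb : (S k' (b k') <= b k'.+1)%N by rewrite bS addnAC leq_addl.
  exists (b k'.+1, y') => _; split => /=.
  - split=> n /=; first by apply: leq_trans (y'S n) _; exact: leq_trans Sb (kb _).
    (* Before [k'] the old word is kept; from [k'] on the letters are at most
       [b k'.+1 < f k' <= f n]. *)
    have [nk'|k'n] := ltnP n k'; first by rewrite -yy'.
    apply: leq_trans (y'S n) (leq_trans Sb _).
    exact: leq_trans (ltnW bf) (f_homo _ _ k'n).
  - by apply: leq_trans _ (kb k'.+1).
  - exact: agree_le kk' yy'.
  - move=> i ik; apply: avoid_le Sb _; apply: y'F; exact: leq_trans kk'.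
pose p j := iter j next (0%N, (fun=> int_of_nat 0) : baireZ).
have pI j : Inv (p j).
  by elim: j => [|j /nextP[]//]; split.
have p_lt j : ((p j).1 < (p j.+1).1)%N by have [] := nextP _ (pI j).
have jp j : (j <= (p j).1)%N.
  by elim: j => // j /leq_ltn_trans; apply; exact: p_lt.
have p_agree i j : (i <= j)%N -> agree (p i).1 (p i).2 (p j).2.
  elim: j => [|j IH]; first by rewrite leqn0 => /eqP->.
  rewrite leq_eqVlt => /orP[/eqP->//|]; rewrite ltnS => ij.
  apply: agree_trans (IH ij) _; have [_ _ + _] := nextP _ (pI j).
  apply: agree_le; elim: j ij {IH} => [|j IH]; first by rewrite leqn0 => /eqP->.
  rewrite leq_eqVlt => /orP[/eqP->//|]; rewrite ltnS => /IH /leq_trans; apply.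
  exact: ltnW.
(* Stage [j] fixes a prefix of length at least [j], so letter [n] is final from stage [n.+1] on. *)
pose x : baireZ := fun n => (p n.+1).2 n.
have x_agree j : agree (p j).1 (p j).2 x.
  move=> n nj; rewrite /x; have [jn|nj'] := leqP j n.+1.
    exact: p_agree jn _ nj.
  by rewrite -(p_agree _ _ (ltnW nj'))//; exact: jp.
have [|i _ Fix] := fF x; first by move=> n; have [_] := pI n.+1; exact.
have [_ _ _ /(_ i (jp i))] := nextP _ (pI i).
by move=> /(_ x (x_agree i.+1)); exact.
Qed.

(** * Transfer of category between Z^N and the reals *)

Section binary_cells.
Local Open Scope ring_scope.
Variable R : realType.
Implicit Types (x y : baireZ) (r : R).

(* [x] is read as the binary expansion whose blocks are [nat_of_int (x i)]
   zeros followed by a one, and [cell k x] is the set of reals whose expansion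
   starts with the first [k] blocks of [x]. *)
Definition cell_width k x : R :=
  \prod_(i < k) 2^-1 ^+ (nat_of_int (x i)).+1.

Definition cell_left k x : R := \sum_(i < k) cell_width i.+1 x.

Definition cell k x : set R :=
  [set r | cell_left k x < r <= cell_left k x + cell_width k x].

Lemma cell_widthS k x :
  cell_width k.+1 x = cell_width k x * 2^-1 ^+ (nat_of_int (x k)).+1.
Proof. by rewrite /cell_width big_ord_recr. Qed.

Lemma cell_leftS k x :
  cell_left k.+1 x = cell_left k x + cell_width k.+1 x.
Proof. by rewrite /cell_left big_ord_recr. Qed.

Lemma cell_width_gt0 k x : 0 < cell_width k x.
Proof. by apply: prodr_gt0 => i _; rewrite exprn_gt0// invr_gt0. Qed.

Lemma cell_width_half k x : cell_width k.+1 x <= cell_width k x / 2.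
Proof.
rewrite cell_widthS ler_pM2l ?cell_width_gt0// exprS.
by rewrite ler_piMr// exprn_ile1 ?invf_le1 ?ler1n.
Qed.

Lemma cell_width_le k x : cell_width k x <= 2^-1 ^+ k.
Proof.
elim: k => [|k IH]; first by rewrite /cell_width big_ord0.
by apply: le_trans (cell_width_half k x) _; rewrite exprSr ler_pM2r ?invr_gt0.
Qed.

Lemma cellS k x r : cell k.+1 x r -> cell k x r.
Proof.
rewrite /cell/= cell_leftS.
have := cell_width_gt0 k.+1 x; have := cell_width_half k x; lra.
Qed.

Lemma agree_cell k x y : agree k x y ->
  cell_left k x = cell_left k y /\ cell_width k x = cell_width k y.
Proof.
move=> xy; split; last by apply: eq_bigr => i _; rewrite xy.
apply: eq_bigr => i _; apply: eq_bigr => j _; rewrite xy//.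
exact: leq_trans (ltn_ord j) (ltn_ord i).
Qed.

Lemma cell_agree k x y r : cell k x r -> cell k y r -> agree k x y.
Proof.
elim: k => [_ _ i //|k IH] xr yr i.
have xy := IH (cellS xr) (cellS yr).
rewrite ltnS leq_eqVlt => /orP[/eqP->{i}|/xy//].
apply: (can_inj nat_of_intK).
have [lxy wxy] := agree_cell xy.
move: xr yr; rewrite /cell/= !cell_leftS !cell_widthS lxy wxy.
have := cell_width_gt0 k y; move: (cell_width k y) (cell_left k y) => w l w0.
set n := nat_of_int _; set m := nat_of_int _.
(* At the first differing block, with [a < b] zeros, the longer one gives
   [r <= l + w 2^-b <= l + w 2^-(a+1)], against the left end of the other cell. *)
suff nm a b : (a < b)%N -> l + w * 2^-1 ^+ a.+1 < r ->
    r <= l + w * 2^-1 ^+ b.+1 + w * 2^-1 ^+ b.+1 -> False.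
  move=> /andP[n1 n2] /andP[m1 m2].
  by case: (ltngtP n m) => // [/nm|/nm] H; [case: (H n1 m2)|case: (H m1 n2)].
move=> ab ar; apply/negP; rewrite -ltNge; apply: le_lt_trans ar.
have : (2^-1 : R) ^+ b <= 2^-1 ^+ a.+1.
  by apply: ler_wiXn2l => //; rewrite ?invf_le1 ?ler1n.
rewrite -(ler_pM2l w0) [_ ^+ b.+1]exprS; lra.
Qed.

(** Cells are open on the left and closed on the right, which selects the expansion with infinitely
    many ones; its blocks are read off by iterating a shift of (0,1]. *)
Lemma cell_exists r : 0 < r <= 1 -> exists x, forall k, cell k x r.
Proof.
have /choice[d dP] : forall s : R, exists n, 0 < s <= 1 ->
    2^-1 ^+ n.+1 < s <= 2^-1 ^+ n.+1 *+ 2.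
  move=> s; have [s01|ns] := pselect (0 < s <= 1); last by exists 0%N.
  have /andP[s0 s1] := s01.
  have exn : exists n, 2^-1 ^+ n < s.
    have [n _ /(_ n (leqnn n)) ns] := near_infty_natSinv_expn_lt (PosNum s0).
    by exists n; move: ns; rewrite div1r exprVn.
  case: (ex_minnP exn) => -[|n] sn smin; first by move: sn; rewrite expr0; lra.
  exists n => _; rewrite sn exprS -mulrnAl -mulr_natr mulVf ?pnatr_eq0// mul1r.
  by rewrite leNgt; apply/negP => /smin; rewrite ltnn.
(* [d s] counts the zeros before the first one of [s], and [T] deletes that block. *)
move=> r01; pose T s := s * 2 ^+ (d s).+1 - 1.
pose s k := iter k T r.
have w0 n : 0 < (2^-1 : R) ^+ n by rewrite exprn_gt0// invr_gt0.
have sE t : t = 2^-1 ^+ (d t).+1 + 2^-1 ^+ (d t).+1 * T t.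
  rewrite /T mulrBr mulr1 mulrCA -exprMn mulVf ?pnatr_eq0// expr1n; lra.
have T01 t : 0 < t <= 1 -> 0 < T t <= 1.
  move=> /dP; have := w0 (d t).+1; have := sE t.
  set w := _ ^+ _; move=> tE wp /andP[wt tw].
  by rewrite -(pmulr_rgt0 _ wp) -(ger_pMr _ wp); lra.
have s01 k : 0 < s k <= 1 by elim: k => // k /T01.
exists (fun k => int_of_nat (d (s k))) => k; set x := fun _ => _.
have rE : r = cell_left k x + cell_width k x * s k.
  elim: k => [|k IH]; first by rewrite /cell_left /cell_width !big_ord0 add0r mul1r.
  rewrite cell_leftS cell_widthS {1}IH {1}(sE (s k)) /x int_of_natK /= -/(s k.+1).
  by rewrite mulrDr mulrA addrA.
have /andP[sk0 sk1] := s01 k; rewrite /cell/= rE ltrDl lerD2l.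
by rewrite mulr_gt0 ?cell_width_gt0//= ger_pMr ?cell_width_gt0.
Qed.

(** The left ends increase strictly and the right ends do not increase, so the supremum of the left
    ends lies in every cell. *)
Lemma cell_point x : exists r, forall k, cell k x r.
Proof.
have left_homo : {homo cell_left^~ x : m n / (m <= n)%N >-> m <= n}.
  apply: homo_leq => [//|? ? ?|k]; first exact: le_trans.
  by rewrite cell_leftS lerDl ltW// cell_width_gt0.
have right_homo : {homo (fun k => cell_left k x + cell_width k x) :
    m n / (m <= n)%N >-> n <= m}.
  apply: homo_leq => [//|? ? ? ba cb|k]; first exact: le_trans cb ba.
  rewrite cell_leftS; have := cell_width_half k x; lra.
have left_le j k : cell_left j x <= cell_left k x + cell_width k x.
  have [jk|/ltnW kj] := leqP j k.
    by apply: le_trans (left_homo _ _ jk) _; rewrite lerDl ltW// cell_width_gt0.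
  by apply: le_trans (right_homo _ _ kj); rewrite lerDl ltW// cell_width_gt0.
exists (sup (range (cell_left^~ x))) => k; apply/andP; split.
  apply: (@lt_le_trans _ _ (cell_left k.+1 x)).
    by rewrite cell_leftS ltrDl cell_width_gt0.
  apply: ub_le_sup; last by exists k.+1.
  by exists (cell_left 0 x + cell_width 0 x) => _ [j _ <-].
apply: ge_sup; first by exists (cell_left 0 x); exists 0%N.
by move=> _ [j _ <-].
Qed.

Lemma cell_close k x r s : cell k x r -> cell k x s -> `|r - s| < 2^-1 ^+ k.
Proof.
rewrite /cell/= => xr xs; apply: lt_le_trans (cell_width_le k x).
rewrite ltr_norml; lra.
Qed.

Lemma pow_half_lt (e : R) : 0 < e -> exists k, 2^-1 ^+ k < e.
Proof.
move=> e0; have [n _ /(_ n (leqnn n))] := near_infty_natSinv_expn_lt (PosNum e0).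
by rewrite div1r -exprVn => ?; exists n.
Qed.

Lemma cell_unique x r s :
  (forall k, cell k x r) -> (forall k, cell k x s) -> r = s.
Proof.
move=> xr xs; apply/eqP; rewrite -subr_eq0 -normr_le0 leNgt.
apply/negP => /pow_half_lt[k]; apply/negP; rewrite -leNgt ltW//.
exact: cell_close.
Qed.

(** The transfer uses only these two clauses: [h] is continuous, and each cylinder contains the
    whole preimage of some nonempty open part of the range. *)
Lemma binary_expansion : exists h : baireZ -> R,
  (forall x (e : R), 0 < e ->
    exists k, forall y, agree k x y -> `|h x - h y| < e) /\
  (forall x k, exists V : set R, [/\ open V, V !=set0, V `<=` range h &
    forall y, V (h y) -> agree k x y]).
Proof.
have /choice[h hP] := cell_point.
exists h; split=> [x e /pow_half_lt[k ke]|x k].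
  exists k => y xy; apply: lt_trans ke; apply: (@cell_close _ x); first exact: hP.
  by have := hP y k; rewrite /cell/=; have [-> ->] := agree_cell xy.
have w0 := cell_width_gt0 k x.
have V0 : 0 < cell_width k x / 2 < cell_width k x by lra.
exists `]cell_left k x, cell_left k x + cell_width k x[%classic.
have VC r : `]cell_left k x, cell_left k x + cell_width k x[%classic r ->
    cell k x r by rewrite /cell/= in_itv/= => /andP[-> /ltW].
split.
- exact: interval_open.
- by exists (cell_left k x + cell_width k x / 2); rewrite /= in_itv/=; lra.
- move=> r /VC Vr; have : cell 0 x r by elim: k Vr {w0 V0 VC} => // k IH /cellS.
  rewrite /cell/= /cell_left /cell_width !big_ord0 add0r => /cell_exists[y yr].
  by exists y => //; exact: (cell_unique (hP y) yr).
- by move=> y /VC xy; exact: cell_agree xy (hP y k).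
Qed.

End binary_cells.

Section category_transfer.
Local Open Scope ring_scope.
Variables (R : realType) (h : baireZ -> R).
Hypothesis h_cont : forall x (e : R), 0 < e ->
  exists k, forall y, agree k x y -> `|h x - h y| < e.
Hypothesis h_open : forall x k, exists V : set R,
  [/\ open V, V !=set0, V `<=` range h & forall y, V (h y) -> agree k x y].

Lemma agree_preimage x (V : set R) : open V -> V (h x) ->
  exists k, forall y, agree k x y -> V (h y).
Proof.
move=> oV Vx; have /nbhs_ballP[e /= e0 eV] : nbhs (h x) V by exact: open_nbhs_nbhs.
have [k kP] := h_cont x e0; exists k => y /kP ye; exact: eV.
Qed.

Lemma meager_preimage N : meager N -> meager (h @^-1` N).
Proof.
move=> [F Fn ->]; rewrite preimage_bigcup; exists (fun n => h @^-1` F n) => [n|//].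
apply/nowhere_dense_baireZ => x k.
have [V [oV V0 Vh Vx]] := h_open x k.
have /nowhere_denseP/(_ V oV V0)[W [oW [r Wr] WV WF]] := Fn n.
have [y _ yr] := Vh _ (WV _ Wr).
have [|m mW] := @agree_preimage y W oW; first by rewrite yr.
exists y, m; split; first by apply: Vx; rewrite yr; exact: WV.
by move=> z /mW Wz Fz; have : set0 (h z) by rewrite -WF.
Qed.

Lemma meager_image M : meager M -> meager (h @` M).
Proof.
move=> [F Fn ->]; rewrite image_bigcup; exists (fun n => h @` F n) => [n|//].
apply/nowhere_denseP => V oV V0.
have [[x Vx]|Vh] := pselect (exists x, V (h x)); last first.
  (* [h] need not be onto: an open set that misses its range is already disjoint from the image. *)
  exists V; split=> //; apply/seteqP; split=> // r [Vr [x _ xr]].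
  by apply: Vh; exists x; rewrite xr.
have [k kV] := agree_preimage oV Vx.
have /nowhere_dense_baireZ/(_ x k)[y [m [xy yF]]] := Fn n.
have [W [oW W0 Wh Wy]] := h_open y (maxn k m).
exists W; split=> //.
  move=> r Wr; have [z _ zr] := Wh _ Wr; rewrite -zr; apply: kV.
  by apply: agree_trans xy (agree_le (leq_maxl _ _) (Wy z _)); rewrite zr.
apply/seteqP; split=> // r [Wr [z Fz zr]]; apply: yF Fz.
by apply: agree_le (leq_maxr _ _) (Wy z _); rewrite zr.
Qed.

End category_transfer.

(** Pulling back along [h] keeps the index family [C], so cof(M) of the reals directly indexes a
    cofinal family in Z^N. *)
Lemma meager_cofinal_baireZ (R : realType) (C : set (set R)) :
  meager_cofinal R C ->
  exists2 h : baireZ -> R, forall N, C N -> meager (h @^-1` N) &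
    forall M, meager M -> exists2 N, C N & M `<=` h @^-1` N.
Proof.
have [h [hc ho]] := binary_expansion R.
move=> [CM Ccof]; exists h => [N /CM|M mM]; first exact: (meager_preimage hc ho).
have [N CN MN] := Ccof _ (meager_image hc ho mM).
by exists N => // x Mx; apply: MN; exists x.
Qed.

(** * Regular cardinals *)

Lemma card_le_lt_trans T U V (A : set T) (B : set U) (K : set V) :
  A #<= B -> B #< K -> A #< K.
Proof.
move=> AB [BK KB]; split; first exact: card_le_trans BK.
by move=> KA; apply: KB; exact: card_le_trans AB.
Qed.

Lemma finite_card_lt T U (A : set T) (K : set U) :
  finite_set A -> infinite_set K -> A #< K.
Proof.
move=> finA infK; split; last by move=> /card_le_finite/(_ finA).
have /finite_setP[n An] := finA.
apply: card_le_trans ((infiniteP _).1 infK).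
by rewrite (card_le_eql An); exact: card_leT.
Qed.

(** A surjection of the union onto [K] turns the [A j] into subsets of [K], to which the definition
    of regularity applies. *)
Lemma regular_bigcup (U : pointedType) (K : set U) I V (J : set I)
    (A : I -> set V) :
  regular_card K -> J #< K -> (forall j, J j -> A j #< K) ->
  ~ (K #<= \bigcup_(j in J) A j).
Proof.
move=> [_ regK] JK AK /pcard_surjP[g gK].
pose B j := K `&` g @` A j.
apply: (regK (B @` J)).
- exact: card_le_lt_trans (card_image_le _ _) JK.
- move=> _ [j Jj <-]; apply: card_le_lt_trans (AK j Jj).
  exact: card_le_trans (subset_card_le (@subIsetr _ _ _)) (card_image_le _ _).
- apply/seteqP; split=> [u [_ [j _ <-] []//]|u Ku].
  have [v [j Jj Av] vu] := gK _ Ku.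
  by exists (B j); [exists j|split=> //; exists v].
Qed.

(* Any well-order of a set equipotent to [K], cut at its first large initial
   segment. *)
Lemma small_segments (U : pointedType) (K : set U) : regular_card K ->
  exists (W : set U) (le : rel U),
    [/\ K #<= W, W #<= K & forall a, W a ->
      [set b | W b /\ ~~ le a b] #< K /\ [set b | W b /\ le b a] #< K].
Proof.
move=> regK; have [le wo] := wochoice.well_ordering_principle U.
have wo_chain : wochoice.wo_chain le predT by move=> A _; exact: wo.
have le_total a b : le a b || le b a by exact: (wochoice.wo_chainW wo_chain).
have le_anti a b : le a b -> le b a -> a = b.
  by move=> ab ba; apply: (wochoice.wo_chain_antisymmetric wo_chain) => //; rewrite ab.
have [W [KW WK Wlt]] : exists W : set U, [/\ K #<= W, W `<=` K &
    forall a, W a -> [set b | W b /\ ~~ le a b] #< K].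
  pose seg a := [set b | K b /\ ~~ le a b].
  have seg_le a W : W `<=` K -> [set b | W b /\ ~~ le a b] #<= K.
    by move=> WK; apply: subset_card_le => b [/WK].
  pose P : pred U := fun a => `[< K a /\ K #<= seg a >].
  (* If some segment is as large as [K], the one below the least such [a] has only smaller initial
     segments; otherwise [K] itself serves. *)
  have [/wo[a [[/asboolP[Ka Ksega] amin] _]]|nP] :=
      pselect (wochoice.nonempty P); last first.
    exists K; split=> // a Ka; split; first exact: seg_le.
    by move=> Kseg; apply: nP; exists a; apply/asboolP.
  exists (seg a); split=> //; first by move=> b [].
  move=> b [Kb ab]; split; first by apply: seg_le => c [].
  move=> Kseg; have : le a b.
    apply: amin; apply/asboolP; split=> //; apply: card_le_trans Kseg _.
    by apply: subset_card_le => c [[Kc _] bc].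
  by rewrite (negbTE ab).
exists W, le; split=> //; first exact: subset_card_le.
move=> a Wa; split; first exact: Wlt.
split; first by apply: subset_card_le => b [/WK].
(* The closed segment is the open one plus [a]; regularity handles this union of two sets because
   [K] is infinite. *)
pose A (i : bool) := if i then [set a] else [set b | W b /\ ~~ le a b].
move=> KA; have := @regular_bigcup _ K _ _ [set: bool] A regK.
apply.
- by apply: finite_card_lt; [exact: finite_finset|case: regK].
- case=> _; last exact: Wlt.
  by apply: finite_card_lt; [exact: finite_set1|case: regK].
- apply: card_le_trans KA _; apply: subset_card_le => b [Wb ba].
  have [->|nba] := pselect (b = a); first by exists true.
  exists false => //; split=> //; apply/negP => ab; apply: nba; exact: le_anti.
Qed.

Lemma meager0 (T : topologicalType) : meager (@set0 T).
Proof.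
exists (fun=> set0); last by rewrite bigcup_const.
move=> _; rewrite /nowhere_dense.
by rewrite closure0 interior0.
Qed.

Lemma nowhere_dense_meager (T : topologicalType) (A : set T) :
  nowhere_dense A -> meager A.
Proof. by move=> nA; exists (fun=> A); rewrite ?bigcup_const. Qed.

Lemma finite_range_bound T (V : nat -> set T) (F : set (set T)) :
  finite_set F -> F `<=` range V ->
  exists N, forall A, F A -> exists2 k, (k <= N)%N & A = V k.
Proof.
move=> finF FV.
have /choice[k kP] : forall A, exists k, F A -> A = V k.
  move=> A; have [/FV[k _ <-]|nF] := pselect (F A); first by exists k.
  by exists 0%N.
have [N NP] : exists N, forall A, F A -> (k A <= N)%N.
  have /finite_seqP[s sE] := finite_image k finF.
  exists (\max_(i <- s) i)%N => A FA.
  have : (k @` F) (k A) by exists A.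
  by rewrite sE /= => ks; exact: leq_bigmax_seq.
by exists N => A FA; exists (k A); [exact: NP|exact: kP].
Qed.

(** * Coordinate sums on a Menger product *)

Section sums.
Variables X Y : set baireZ.
Local Open Scope ring_scope.
Let XY : topologicalType := (set_type X * set_type Y)%type.

Definition sum_coord (n : nat) (p : XY) : nat :=
  nat_of_int ((\val p.1 n : int) + \val p.2 n).

Lemma open_sum_coord n k : open [set p | (sum_coord n p <= k)%N].
Proof.
rewrite openE => p pk.
have fst_near : \forall q \near p, \val q.1 n = \val p.1 n.
  have c1 : {for p, continuous (fun q : XY => \val q.1 : baireZ)}.
    apply: (@continuous_comp XY (set_type X) baireZ); first exact: cvg_fst.
    exact: initial_continuous.
  have : nbhs (\val p.1 : baireZ) [set x : baireZ | x n = \val p.1 n].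
    by apply/nbhs_baireZ; exists n.+1 => y /(_ n (ltnSn n)).
  exact: c1.
have snd_near : \forall q \near p, \val q.2 n = \val p.2 n.
  have c2 : {for p, continuous (fun q : XY => \val q.2 : baireZ)}.
    apply: (@continuous_comp XY (set_type Y) baireZ); first exact: cvg_snd.
    exact: initial_continuous.
  have : nbhs (\val p.2 : baireZ) [set x : baireZ | x n = \val p.2 n].
    by apply/nbhs_baireZ; exists n.+1 => y /(_ n (ltnSn n)).
  exact: c2.
apply: filterS (filterI fst_near snd_near) => q [q1 q2].
by rewrite /= /sum_coord q1 q2.
Qed.

(* Menger's property is applied to every tail of the sequence of covers, so
   that each point is caught at arbitrarily large coordinates. *)
Lemma menger_sum_bound : menger XY ->
  exists2 f : nat -> nat, {homo f : m n / (m <= n)%N} &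
    forall p N, exists2 n, (N <= n)%N & (sum_coord n p <= f n)%N.
Proof.
move=> mXY.
have /choice[G GP] : forall m, exists G : nat -> nat, forall p, exists n,
    (sum_coord (m + n) p <= G n)%N.
  move=> m; pose V n k := [set p : XY | (sum_coord (m + n) p <= k)%N].
  have [n|F [FV Fcover]] := mXY (fun n => range (V n)).
    split=> [_ [k _ <-]|]; first exact: open_sum_coord.
    apply/seteqP; split=> // p _.
    by exists (V n (sum_coord (m + n) p)); [exists (sum_coord (m + n) p)|rewrite /V/=].
  have /choice[G GP] : forall n, exists N, forall A, F n A ->
      exists2 k, (k <= N)%N & A = V n k.
    by move=> n; have [finF FVn] := FV n; exact: finite_range_bound.
  exists G => p; have [n _ [A FA Ap]] : (\bigcup_n \bigcup_(A in F n) A) p.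
    by rewrite Fcover.
  have [k kG AV] := GP n A FA; exists n; move: Ap; rewrite AV => /leq_trans; exact.
(* [G' k] adds the bounds at coordinate [k] from all tails starting at some [i <= k]; partial sums
   then make the bound monotone. *)
pose G' k := (\sum_(i < k.+1) G i (k - i))%N.
exists (fun n => \sum_(k < n.+1) G' k)%N.
  apply: homo_leq => [//|? ? ?|n]; first exact: leq_trans.
  by rewrite [leqRHS]big_ord_recr leq_addr.
move=> p N; have [n nG] := GP N p; exists (N + n)%N; first exact: leq_addr.
apply: (leq_trans nG); rewrite big_ord_recr /= (leq_trans _ (leq_addl _ _))//.
have Nn : (N < (N + n).+1)%N by rewrite ltnS leq_addr.
by rewrite /G' (bigD1 (Ordinal Nn))//= addKn leq_addr.
Qed.

End sums.

(** * Construction of the Luzin set [Y] *)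

Theorem theorem3p1 (R : realType) :
  cov_meager R #= cof_meager R ->
  regular_card (cov_meager R) ->
  forall X : set baireZ, luzin (cov_meager R) X ->
  exists Y : set baireZ,
    luzin (cov_meager R) Y /\ ~ menger (set_type X * set_type Y)%type.
Proof.
move=> KC regK X [KX XM]; set K := cov_meager R in KC regK KX XM *.
have [[Cm Ccof] _] := cof_meagerP R; set C := cof_meager R in KC Cm Ccof.
have [h hm hcof] := @meager_cofinal_baireZ R C (conj Cm Ccof).
have [W [le [KW WK seg]]] := small_segments regK.
have [e eC] : exists e : set R -> set R, set_surj W C e.
  apply/pcard_surjP; apply: card_le_trans KW.
  by move: KC; rewrite card_eq_le => /andP[].
(* Outside [W] the value [e a] may leave [C]; the first conjunct then empties [M a], so that every
   index gives a meager set. *)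
pose M a := [set x | C (e a) /\ h x \in e a].
have Mm a : meager (M a).
  have [Ce|nCe] := pselect (C (e a)).
    by have := hm _ Ce; congr meager; apply/seteqP; split => x;
      rewrite /M /= inE => // -[].
  have -> : M a = set0 by apply/seteqP; split=> // x [].
  exact: meager0.
have Mcof A : meager A -> exists2 a, W a & A `<=` M a.
  move=> /hcof[N CN AN]; have [a Wa aN] := eC _ CN.
  by exists a => // x /AN; rewrite /M /= aN inE.
have /choice[g gP] a := domination (Mm a).
(* By the successor, [z a] is strictly above [g a] everywhere, hence eventually above each monotone
   [f] with [below f] inside [M a]. *)
pose z a : baireZ := fun n => int_of_nat (g a n).+1.
have /choice[x xP] : forall a, exists x, W a ->
    X x /\ forall b, W b -> le b a -> ~ M b (reflect_at (z a) x).
  move=> a; have [Wa|nWa] := pselect (W a); last by exists (z a).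
  apply: contrapT => nx.
  apply: (@regular_bigcup _ K _ _ [set b | W b /\ le b a]
    (fun b => X `&` reflect_at (z a) @^-1` M b) regK (proj2 (seg a Wa))).
    by move=> b _; apply: XM; exact: meager_reflect.
  apply: card_le_trans KX _; apply: subset_card_le => x Xx.
  apply: contrapT => xM; apply: nx; exists x => _; split=> // b Wb ba Mb.
  by apply: xM; exists b.
pose y a := reflect_at (z a) (x a).
have yM a b : W a -> W b -> M a (y b) -> ~~ le a b.
  move=> Wa Wb Mab; apply/negP => ab.
  by have [_ /(_ a Wa ab)] := xP b Wb.
exists (y @` W); split.
  split.
    apply: contrapT => KY.
    have YK : (y @` W) #< K.
      by split=> //; exact: card_le_trans (card_image_le _ _) WK.
    (* A small [Y] would split [W] into fewer than [K] fibres of [y]. Each fibre is small: its value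
       [v] lies in a nowhere dense box, hence in some [M a], which confines the fibre to the indices
       before [a]. *)
    apply: (@regular_bigcup _ K _ _ (y @` W)
      (fun v => [set a | W a /\ y a = v]) regK YK) => [v _|].
      have [a Wa va] := Mcof _
        (nowhere_dense_meager (nowhere_dense_below (fun n => nat_of_int (v n)))).
      apply: card_le_lt_trans (proj1 (seg a Wa)); apply: subset_card_le.
      by move=> b [Wb bv]; split=> //; apply: yM => //; rewrite bv; apply: va => n.
    apply: card_le_trans KW _; apply: subset_card_le => a Wa.
    by exists (y a) => //; exists a.
  move=> A /Mcof[a Wa AM]; apply: card_le_lt_trans (proj1 (seg a Wa)).
  apply: card_le_trans (card_image_le y _); apply: subset_card_le.
  by move=> _ [[b Wb <-] /AM Mab]; exists b => //; split=> //; exact: yM.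
move=> /menger_sum_bound[f f_homo fP].
(* For an [M a] containing the box [below f], [g a] eventually dominates [f], while [x a] and [y a]
   have sum [z a], which exceeds [g a]. *)
have [a Wa fM] := Mcof _ (nowhere_dense_meager (nowhere_dense_below f)).
have [N fg] := gP a f f_homo fM.
have Xxa : x a \in X by rewrite inE; have [] := xP a Wa.
have Yya : y a \in y @` W by rewrite inE; exists a.
have [n Nn] := fP (SigSub Xxa, SigSub Yya) N.
rewrite /sum_coord /= /y /reflect_at GRing.addrC GRing.subrK int_of_natK.
by move=> /leq_trans/(_ (fg n Nn)); rewrite ltnn.
Qed.
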